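(* Let $\mathcal G$ be an $\mathrm{MD}_{n-2}(n)$-algebra with $n\ge6$, $\dim\mathcal G^1=2$ and $\mathcal G^1$ contained in the centre of $\mathcal G$. (a) If $n=6$, then $\mathcal G$ is isomorphic to the Lie algebra with basis $\{x_1,\dots,x_6\}$ whose only nonzero brackets (up to antisymmetry) are $[x_1,x_3]=x_5$, $[x_1,x_4]=-x_6$, $[x_2,x_3]=-x_6$, $[x_2,x_4]=-x_5$. (b) If $n=10$, then $\mathcal G$ is isomorphic to one of the following Lie algebras on a basis $\{x_1,\dots,x_{10}\}$ (only nonzero brackets listed, up to antisymmetry): $\mathcal G_{10,1}(\mu,\lambda)$ with $\mu\in\mathbb R$, $0<|\lambda|\le1$: $[x_1,x_3]=x_9$, $[x_1,x_4]=-x_{10}$, $[x_2,x_3]=-x_{10}$, $[x_2,x_4]=-x_9$, $[x_5,x_7]=\lambda x_9$, $[x_5,x_8]=\mu x_9-x_{10}$, $[x_6,x_7]=\mu x_9-x_{10}$, $[x_6,x_8]=-\lambda x_9$; $\mathcal G_{10,2}(\lambda)$ with $\lambda\neq0$: $[x_1,x_7]=\lambda x_9$, $[x_1,x_8]=-x_{10}$, $[x_2,x_7]=-x_{10}$, $[x_2,x_8]=-\lambda x_9$, $[x_3,x_5]=\lambda x_9$, $[x_3,x_6]=-x_{10}$, $[x_3,x_8]=x_9$, $[x_4,x_5]=-x_{10}$, $[x_4,x_6]=-\lambda x_9$, $[x_4,x_7]=x_9$.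
   Context: $\mathcal G^1=[\mathcal G,\mathcal G]$. An $\mathrm{MD}_k(n)$-algebra is an $n$-dimensional real solvable Lie algebra all of whose non-trivial coadjoint orbits (for its connected simply connected Lie group; $\dim\Omega_F=\operatorname{rank}(F([x_i,x_j]))$ for a basis $\{x_i\}$, non-trivial iff $F|_{\mathcal G^1}\ne0$) have dimension $k$. *)

(* Defs.v *)
From HB Require Import structures.
From mathcomp Require Import all_boot all_order all_algebra.
From mathcomp Require Import reals.
Set Implicit Arguments. Unset Strict Implicit. Unset Printing Implicit Defensive.
Import Order.TTheory GRing.Theory Num.Theory.
Local Open Scope ring_scope.

Section LieDefs.
Variable R : realType.

(* A (candidate) n-dimensional algebra on R^n given by structure constants:
   c i j = [e_i, e_j] (row vector of coordinates).  Vectors are row vectors. *)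
Definition strconst (n : nat) := 'I_n -> 'I_n -> 'rV[R]_n.

Definition br n (c : strconst n) (u v : 'rV[R]_n) : 'rV[R]_n :=
  \sum_(i < n) \sum_(j < n) (u 0 i * v 0 j) *: c i j.

Definition is_lie n (c : strconst n) : Prop :=
  (forall u, br c u u = 0) /\
  (forall u v w, br c u (br c v w) + br c v (br c w u) + br c w (br c u v) = 0).

Definition derived_sub n (c : strconst n) (S : 'M[R]_n) : 'M[R]_n :=
  (\sum_(a < n) \sum_(b < n) <<br c (row a S) (row b S)>>)%MS.

Definition derived n (c : strconst n) : 'M[R]_n := derived_sub c 1%:M.

Definition is_solvable n (c : strconst n) : Prop :=
  exists k, iter k (derived_sub c) 1%:M = 0.

Definition in_centre n (c : strconst n) (S : 'M[R]_n) : Prop :=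
  forall u, (u <= S)%MS -> forall v, br c u v = 0.

(* F in G^* represented by a column vector: F(x) = (x *m F) 0 0 *)
Definition appF n (F : 'cV[R]_n) (x : 'rV[R]_n) : R := (x *m F) 0 0.

(* dimension of the coadjoint orbit of F *)
Definition orbit_dim n (c : strconst n) (F : 'cV[R]_n) : nat :=
  \rank (\matrix_(i < n, j < n) appF F (c i j)).

(* MD_k(n)-algebra: solvable real Lie algebra whose non-trivial coadjoint
   orbits (F restricted to G^1 nonzero) all have dimension k *)
Definition is_MD n (k : nat) (c : strconst n) : Prop :=
  is_lie c /\ is_solvable c /\
  forall F : 'cV[R]_n,
    (exists u, (u <= derived c)%MS /\ appF F u != 0) -> orbit_dim c F = k.

Definition lie_iso n (c d : strconst n) : Prop :=
  exists P : 'M[R]_n, P \in unitmx /\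
    forall u v, br c u v *m P = br d (u *m P) (v *m P).

(* antisymmetric closure of a list of brackets [x_i, x_j] for i < j *)
Definition sc n (f : nat -> nat -> 'rV[R]_n) : strconst n :=
  fun i j => f i j - f j i.

(* basis vector x_(k+1) (0-based index k) *)
Definition ee n (k : nat) : 'rV[R]_n.+1 := delta_mx 0 (inord k).

(* 0-based indices: x_1 is index 0 *)
Definition g6f (i j : nat) : 'rV[R]_6 :=
  match i, j with
  | 0, 2 => ee 5 4
  | 0, 3 => - ee 5 5
  | 1, 2 => - ee 5 5
  | 1, 3 => - ee 5 4
  | _, _ => 0
  end.
Definition G6 : strconst 6 := sc g6f.

Definition g10_1f (mu lam : R) (i j : nat) : 'rV[R]_10 :=
  match i, j with
  | 0, 2 => ee 9 8
  | 0, 3 => - ee 9 9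
  | 1, 2 => - ee 9 9
  | 1, 3 => - ee 9 8
  | 4, 6 => lam *: ee 9 8
  | 4, 7 => mu *: ee 9 8 - ee 9 9
  | 5, 6 => mu *: ee 9 8 - ee 9 9
  | 5, 7 => - (lam *: ee 9 8)
  | _, _ => 0
  end.
Definition G10_1 (mu lam : R) : strconst 10 := sc (g10_1f mu lam).

Definition g10_2f (lam : R) (i j : nat) : 'rV[R]_10 :=
  match i, j with
  | 0, 6 => lam *: ee 9 8
  | 0, 7 => - ee 9 9
  | 1, 6 => - ee 9 9
  | 1, 7 => - (lam *: ee 9 8)
  | 2, 4 => lam *: ee 9 8
  | 2, 5 => - ee 9 9
  | 2, 7 => ee 9 8
  | 3, 4 => - ee 9 9
  | 3, 5 => - (lam *: ee 9 8)
  | 3, 6 => ee 9 8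
  | _, _ => 0
  end.
Definition G10_2 (lam : R) : strconst 10 := sc (g10_2f lam).

End LieDefs.

(* Main.v *)
Require Import Defs.
From HB Require Import structures.
From mathcomp Require Import all_boot all_order all_algebra.
From mathcomp Require Import reals.
From mathcomp Require Import complex ring zify.
Import Order.TTheory GRing.Theory Num.Theory.
Local Open Scope ring_scope.

Set Implicit Arguments.
Unset Strict Implicit.
Unset Printing Implicit Defensive.

(* Modulo its central derived algebra the Lie algebra is R^(n-2) with two alternating forms A, B,
   and the orbit condition says that every nonzero real combination of A and B is nondegenerate.
   The operator T = A B^-1 has no real eigenvalue and is self-adjoint for B, so its cyclic
   subspaces are isotropic and everything is governed by the values B(x T^i, y).  Some a <> 0 is
   killed by a real quadratic polynomial of T, which an affine change of the pencil turns into
   N = T^2 + 1.  For n = 6, a, aT and a dual pair y, yT form the required basis.  For n = 10,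
   either some x has x N <> 0 = x N^2, and x together with a dual cyclic vector y gives
   G10_2(1); or a and a dual y in ker N span a nondegenerate T-invariant 4-space, whose orthogonal
   complement contains a second such block, and this gives G10_1, where |lambda| <= 1 is
   obtained by possibly exchanging the two blocks. *)

(** * Bilinear forms of matrices *)

Definition form (R : realType) (m : nat) (A : 'M[R]_m) (u v : 'rV[R]_m) : R :=
  (u *m A *m v^T) 0 0.

Lemma formDl (R : realType) m (A : 'M[R]_m) u1 u2 v :
  form A (u1 + u2) v = form A u1 v + form A u2 v.
Proof. by rewrite /form !mulmxDl mxE. Qed.

Lemma formZl (R : realType) m (A : 'M[R]_m) k u v :
  form A (k *: u) v = k * form A u v.
Proof. by rewrite /form -!scalemxAl mxE. Qed.

Lemma formNl (R : realType) m (A : 'M[R]_m) u v : form A (- u) v = - form A u v.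
Proof. by rewrite -scaleN1r formZl mulN1r. Qed.

Lemma form0l (R : realType) m (A : 'M[R]_m) v : form A 0 v = 0.
Proof. by rewrite -(scale0r 0) formZl mul0r. Qed.

Lemma formDr (R : realType) m (A : 'M[R]_m) u v1 v2 :
  form A u (v1 + v2) = form A u v1 + form A u v2.
Proof. by rewrite /form linearD /= mulmxDr mxE. Qed.

Lemma formZr (R : realType) m (A : 'M[R]_m) k u v :
  form A u (k *: v) = k * form A u v.
Proof. by rewrite /form linearZ /= -scalemxAr mxE. Qed.

Lemma formNr (R : realType) m (A : 'M[R]_m) u v : form A u (- v) = - form A u v.
Proof. by rewrite -scaleN1r formZr mulN1r. Qed.

Lemma form_comb (R : realType) m (A B : 'M[R]_m) s t u v :
  form (s *: A + t *: B) u v = s * form A u v + t * form B u v.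
Proof.
by rewrite /form mulmxDr mulmxDl mxE -!scalemxAr -!scalemxAl !mxE.
Qed.

Lemma form_suml (R : realType) m (A : 'M[R]_m) n (c : 'I_n -> R) x v :
  form A (\sum_i c i *: x i) v = \sum_i c i * form A (x i) v.
Proof.
elim/big_rec2: _ => [|i a b _ <-]; first by rewrite form0l.
by rewrite formDl formZl.
Qed.

Lemma form_sum (R : realType) m (A : 'M[R]_m) u v :
  form A u v = \sum_i \sum_j u 0 i * v 0 j * A i j.
Proof.
rewrite /form mxE exchange_big /=; apply: eq_bigr => j _.
by rewrite !mxE mulr_suml; apply: eq_bigr => i _; rewrite mulrAC.
Qed.

Definition alternating (R : realType) m (A : 'M[R]_m) : Prop :=
  forall u, form A u u = 0.

Lemma formC (R : realType) m (A : 'M[R]_m) u v :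
  alternating A -> form A u v = - form A v u.
Proof.
move=> altA; move: (altA (u + v)).
by rewrite formDl !formDr !altA add0r addr0 => /eqP; rewrite addr_eq0 => /eqP.
Qed.

(** * Pencils of alternating forms and their operator *)

Definition pencil (R : realType) m (A B : 'M[R]_m) : Prop :=
  [/\ alternating A, alternating B
    & forall s t, (s != 0) || (t != 0) -> s *: A + t *: B \in unitmx].

Lemma pencil_unit (R : realType) m (A B : 'M[R]_m) :
  pencil A B -> B \in unitmx.
Proof.
case=> _ _ /(_ 0 1); rewrite oner_eq0 orbT scale0r add0r scale1r; exact.
Qed.

(** This replaces the operator [T] by [(T - k) / l] and keeps [B]. The induced substitution in the
    coefficients [(s, t)] is invertible, so nondegeneracy survives. *)
Lemma pencil_affine (R : realType) m (A B : 'M[R]_m) (k l : R) :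
  l != 0 -> pencil A B -> pencil (l^-1 *: A + (- k / l) *: B) B.
Proof.
move=> l0 [altA altB nd]; split=> // [u|s t st].
  by rewrite form_comb altA altB !mulr0 addr0.
have -> : s *: (l^-1 *: A + (- k / l) *: B) + t *: B
   = (s / l) *: A + (t - s * k / l) *: B.
  rewrite scalerDr !scalerA -addrA -scalerDl; congr (_ + _ *: _).
  by rewrite mulNr mulrN mulrA addrC.
apply: nd; case: (eqVneq s 0) st => [->|s0] /=.
  by rewrite !mul0r subr0 eqxx.
by rewrite mulf_neq0 ?invr_eq0.
Qed.

Definition pencil_op (R : realType) m (A B : 'M[R]_m) : 'M[R]_m := A *m invmx B.

Lemma pencil_opK (R : realType) m (A B : 'M[R]_m) :
  pencil A B -> pencil_op A B *m B = A.
Proof. by move=> /pencil_unit uB; rewrite /pencil_op mulmxKV. Qed.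

Lemma pencil_op_affine (R : realType) m (A B : 'M[R]_m) (k l : R) (u : 'rV_m) :
  pencil A B ->
  u *m pencil_op (l^-1 *: A + (- k / l) *: B) B
  = l^-1 *: (u *m pencil_op A B - k *: u).
Proof.
move=> /pencil_unit uB.
rewrite /pencil_op mulmxDl -!scalemxAl mulmxV // mulmxDr -!scalemxAr mulmx1.
by rewrite scalerBr scalerA mulNr scaleNr mulrC.
Qed.

(** The vector [u T^k]; as an iterate, [orb T 2 u] is convertible to [u *m T *m T]. *)
Definition orb (R : realType) m (T : 'M[R]_m) (k : nat) (u : 'rV[R]_m) :=
  iter k (fun v => v *m T) u.

Lemma orbS (R : realType) m (T : 'M[R]_m) k u :
  orb T k.+1 u = orb T k u *m T.
Proof. by []. Qed.

Lemma orbD (R : realType) m (T : 'M[R]_m) j k u :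
  orb T (j + k) u = orb T j (orb T k u).
Proof. exact: iterD. Qed.

Lemma orbDv (R : realType) m (T : 'M[R]_m) k u v :
  orb T k (u + v) = orb T k u + orb T k v.
Proof. by elim: k => //= k ->; rewrite mulmxDl. Qed.

Lemma orbZv (R : realType) m (T : 'M[R]_m) k a u :
  orb T k (a *: u) = a *: orb T k u.
Proof. by elim: k => //= k ->; rewrite -scalemxAl. Qed.

Lemma form_op (R : realType) m (A B : 'M[R]_m) u v :
  pencil A B -> form B (u *m pencil_op A B) v = form A u v.
Proof. by move=> AB; rewrite /form -(mulmxA u) pencil_opK. Qed.

Lemma form_op_sym (R : realType) m (A B : 'M[R]_m) u v :
  pencil A B -> form B (u *m pencil_op A B) v = form B u (v *m pencil_op A B).
Proof.
move=> AB; have [altA altB _] := AB.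
by rewrite (formC u _ altB) !form_op // formC.
Qed.

(** Self-adjointness moves every power of [T] to the left, so a pairing of two orbits depends only
    on [i + j]. *)
Lemma formB_orb (R : realType) m (A B : 'M[R]_m) i j u v :
  pencil A B ->
  form B (orb (pencil_op A B) i u) (orb (pencil_op A B) j v)
  = form B (orb (pencil_op A B) (i + j) u) v.
Proof.
move=> AB; elim: j i => [|j IH] i; first by rewrite addn0.
by rewrite [orb _ j.+1 v]orbS -form_op_sym // -orbS IH addSnnS.
Qed.

Lemma formA_orb (R : realType) m (A B : 'M[R]_m) i j u v :
  pencil A B ->
  form A (orb (pencil_op A B) i u) (orb (pencil_op A B) j v)
  = form B (orb (pencil_op A B) (i + j).+1 u) v.
Proof. by move=> AB; rewrite -(form_op _ _ AB) -orbS formB_orb. Qed.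

(* The operator is self-adjoint for the alternating form [B], so cyclic subspaces are isotropic. *)
Lemma formB_orb_diag (R : realType) m (A B : 'M[R]_m) i u :
  pencil A B -> form B (orb (pencil_op A B) i u) u = 0.
Proof.
move=> AB; have [_ altB _] := AB.
have := formB_orb 0 i u u AB; rewrite add0n /= formC // => /eqP.
by rewrite eq_sym -addr_eq0 -mulr2n mulrn_eq0 => /= /eqP.
Qed.

(** Multiplied by [B], the relation puts [u] in the kernel of [t A + s B]. In particular [T] has no
    real eigenvector. *)
Lemma pencil_orb_indep (R : realType) m (A B : 'M[R]_m) s t (u : 'rV_m) :
  pencil A B -> u != 0 -> s *: u + t *: (u *m pencil_op A B) = 0 ->
  s = 0 /\ t = 0.
Proof.
move=> AB u0 /(congr1 (mulmx^~ B)); have [_ _ nd] := AB.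
rewrite mul0mx mulmxDl -!scalemxAl -mulmxA pencil_opK // addrC !scalemxAr -mulmxDr.
have [-> | t0] := eqVneq t 0; last first.
  have /mulmxK/(_ u) ut : t *: A + s *: B \in unitmx by rewrite nd ?t0.
  by move=> e; rewrite e mul0mx in ut; rewrite -ut eqxx in u0.
have [-> // | s0] := eqVneq s 0.
have /mulmxK/(_ u) us : 0 *: A + s *: B \in unitmx by rewrite nd ?s0 ?orbT.
by move=> e; rewrite e mul0mx in us; rewrite -us eqxx in u0.
Qed.

(** * Independent families and dual vectors *)

Definition indep (R : realType) m k (x : 'I_k -> 'rV[R]_m) : Prop :=
  forall c : 'I_k -> R, \sum_i c i *: x i = 0 -> forall i, c i = 0.

Lemma indep_row_free (R : realType) m k (x : 'I_k -> 'rV[R]_m) :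
  indep x -> row_free (\matrix_i x i).
Proof.
move=> ind; apply: inj_row_free => v; rewrite mulmx_sum_row.
under eq_bigr do rewrite rowK.
by move=> /ind v0; apply/rowP => i; rewrite v0 mxE.
Qed.

(** The rows [x i] remain independent after multiplication by [B], so the linear system for [y] has
    a right inverse. *)
Lemma form_solve (R : realType) m k (B : 'M[R]_m) (x : 'I_k -> 'rV[R]_m)
    (r : 'I_k -> R) :
  B \in unitmx -> indep x -> exists y, forall i, form B (x i) y = r i.
Proof.
move=> uB /indep_row_free fx.
have : row_free ((\matrix_i x i) *m B) by rewrite /row_free mxrankMfree // row_free_unit.
move=> /row_freeP [X eX].
exists (X *m \col_i r i)^T => i.
have : ((\matrix_i x i) *m B *m (X *m \col_i r i)) i 0 = r i.
  by rewrite mulmxA eX mul1mx mxE.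
move=> <-; rewrite /form trmxK.
have -> : x i = row i (\matrix_i x i) by rewrite rowK.
by rewrite -!row_mul [in LHS]mxE.
Qed.

Lemma ex_orthogonal (R : realType) m k (B : 'M[R]_m) (x : 'I_k -> 'rV[R]_m) :
  (k < m)%N -> exists2 y, y != 0 & forall i, form B (x i) y = 0.
Proof.
move=> km; pose X := ((\matrix_i x i) *m B)^T.
have /rowV0Pn [y /sub_kermxP ky y0] : kermx X != 0.
  rewrite -mxrank_eq0 mxrank_ker subn_eq0 -ltnNge.
  exact: leq_ltn_trans (rank_leq_col _) km.
exists y => // i.
have <- : ((\matrix_i x i) *m B *m y^T) i 0 = form B (x i) y.
  have -> : x i = row i (\matrix_i x i) by rewrite rowK.
  by rewrite /form -!row_mul [in RHS]mxE.
by rewrite -[_ *m B]trmxK -trmx_mul ky trmx0 mxE.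
Qed.

Arguments orb : simpl never.

(** * Vectors annihilated by a real quadratic polynomial *)

Lemma complex_quadratic (R : rcfType) (a b : R) :
  ('X - (Complex a b)%:P) * ('X - (Complex a (- b))%:P)
  = ('X - (real_complex R a)%:P) ^+ 2 + (real_complex R (b ^+ 2))%:P.
Proof.
have -> : Complex a b = real_complex R a + Complex 0 b by simpc.
have -> : Complex a (- b) = real_complex R a - Complex 0 b by simpc.
have -> : real_complex R (b ^+ 2) = - Complex 0 b ^+ 2.
  by rewrite !expr2; simpc.
by rewrite !(rmorphD, rmorphN, rmorphXn) /=; ring.
Qed.

(** Over the complex numbers [p] equals its conjugate, so [p ^+ 2] is the product over the roots [z]
    of [(X - z) (X - conj z)]. Squaring avoids matching conjugate roots inside [p]. *)
Lemma sqr_prod_quadratics (R : rcfType) (p : {poly R}) :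
  p \is monic ->
  exists s : seq (R * R),
    p ^+ 2 = \prod_(z <- s) (('X - z.1%:P) ^+ 2 + (z.2 ^+ 2)%:P).
Proof.
move=> mp; pose toC := real_complex R; pose pC := map_poly toC p.
have [r er] := closed_field_poly_normal pC.
have mpC : lead_coef pC = 1 by rewrite lead_coef_map (eqP mp) rmorph1.
rewrite mpC scale1r in er.
have er' : pC = \prod_(z <- r) ('X - (conjc z)%:P).
  have -> : pC = map_poly conjc pC.
    rewrite /pC -map_poly_comp; apply: eq_map_poly => x /=.
    exact/esym/conjc_real.
  rewrite er rmorph_prod; apply: eq_bigr => z _.
  by rewrite rmorphB /= map_polyX map_polyC.
exists [seq (complex.Re z, complex.Im z) | z <- r].
apply: (map_poly_inj toC); rewrite rmorphXn /= -/pC expr2 {1}er er' -big_split /=.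
rewrite big_map rmorph_prod /=; apply: eq_bigr => -[a b] _ /=.
rewrite rmorphD rmorphXn rmorphB /= map_polyX !map_polyC.
exact: complex_quadratic.
Qed.

(* Cayley-Hamilton for the squared characteristic polynomial, a product of real quadratics: the
   vector is the last nonzero one among the images of [u] under the partial products. *)
Lemma ex_quadratic_vector (R : realType) m (T : 'M[R]_m)
    (S : 'rV[R]_m -> Prop) (u : 'rV[R]_m) :
  (forall a b v, S v ->
     S (v *m T *m T - (2 * a) *: (v *m T) + (a ^+ 2 + b ^+ 2) *: v)) ->
  S u -> u != 0 ->
  exists a b w, [/\ S w, w != 0 &
    w *m T *m T = (2 * a) *: (w *m T) - (a ^+ 2 + b ^+ 2) *: w].
Proof.
case: m T S u => [|m] T S u stab Su u0; first by rewrite thinmx0 eqxx in u0.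
have [s es] := sqr_prod_quadratics (char_poly_monic T).
have : u *m horner_mx T (\prod_(z <- s) (('X - z.1%:P) ^+ 2 + (z.2 ^+ 2)%:P)) = 0.
  by rewrite -es rmorphXn /= Cayley_Hamilton expr2 mul0r mulmx0.
elim: s u Su u0 {es} => [|[a b] s IH] u Su u0.
  by rewrite big_nil rmorph1 mulmx1 => e; rewrite e eqxx in u0.
rewrite big_cons rmorphM /= -mulmxE mulmxA.
set w := u *m _.
have ew : w = u *m T *m T - (2 * a) *: (u *m T) + (a ^+ 2 + b ^+ 2) *: u.
  rewrite /w rmorphD /= rmorphXn rmorphB /= horner_mx_X !horner_mx_C expr2 -mulmxE.
  rewrite mulmxDr mulmxA !mulmxBr !mul_mx_scalar mulmxBl -!scalemxAl.
  move: (u *m T *m T) (u *m T) => x y; apply/rowP => i; rewrite !mxE; ring.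
have [w0|w0] := eqVneq w 0; last by move=> /IH; apply=> //; rewrite ew; apply: stab.
move=> _; exists a, b, u; split=> //.
move: w0; rewrite ew -addrA => /eqP; rewrite addr_eq0 opprD opprK => /eqP ->.
by [].
Qed.

(** * Normal forms of pencils *)

Definition centre_vec (R : realType) m (k : 'I_2) : 'rV[R]_(m + 2) :=
  delta_mx 0 (rshift m k).

Definition tabulated (R : realType) m (d : strconst R (m + 2)) (p q : nat -> nat -> R) :=
  [/\ forall i j : 'I_m, d (lshift 2 i) (lshift 2 j)
        = (p i j - p j i) *: centre_vec R m 0 + (q i j - q j i) *: centre_vec R m 1,
      forall k j, d (rshift m k) j = 0
    & forall i k, d i (rshift m k) = 0].

(* In a suitable basis [A = r P + s Q] and [B = Q], where [P], [Q] are the alternating matrices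
   with upper parts [p], [q]; such a shear of the pencil is a change of basis of the centre. *)
Definition realizes (R : realType) m (A B : 'M[R]_m) (p q : nat -> nat -> R) : Prop :=
  exists (v : 'I_m -> 'rV[R]_m) (r s : R), [/\ r != 0,
    row_free (\matrix_i v i),
    forall i j : 'I_m, form A (v i) (v j) = r * (p i j - p j i) + s * (q i j - q j i)
    & forall i j : 'I_m, form B (v i) (v j) = q i j - q j i].

Lemma realizes_affine (R : realType) m (A B : 'M[R]_m) (k l : R) p q :
  l != 0 -> realizes (l^-1 *: A + (- k / l) *: B) B p q -> realizes A B p q.
Proof.
(* If [A'] is the modified form, then [A = l A' + k B], which gives the new shear. *)
move=> l0 [v [r [s [r0 fv eA eB]]]]; exists v, (l * r), (l * s + k); split=> //.
  by rewrite mulf_neq0.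
move=> i j; have := eA i j; rewrite form_comb eB => /(canRL (addrK _)) /(canRL (mulKf _)) ->.
  by field.
by rewrite invr_eq0.
Qed.

(** In the alternating matrix of [q], column [pi i] has its only nonzero entry in row [i]. Pairing a
    vanishing combination with [v (pi i)] therefore isolates its [i]-th coefficient, and
    independence follows from the Gram entries above the diagonal. *)
Lemma realizes_gram (R : realType) m (A B : 'M[R]_m) (v : 'I_m -> 'rV[R]_m)
    (r s : R) (p q : nat -> nat -> R) (pi : nat -> nat) :
  alternating A -> alternating B -> r != 0 ->
  (forall i j, (j <= i)%N -> p i j = 0 /\ q i j = 0) ->
  (forall i : 'I_m, (pi i < m)%N) ->
  (forall i j : 'I_m, (q j (pi i) - q (pi i) j != 0) = (i == j)) ->
  (forall i j : 'I_m, (i < j)%N ->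
     form A (v i) (v j) = r * p i j + s * q i j /\ form B (v i) (v j) = q i j) ->
  realizes A B p q.
Proof.
move=> altA altB r0 up pim mono gram.
have eA i j : form A (v i) (v j) = r * (p i j - p j i) + s * (q i j - q j i).
  case: (ltngtP i j) => [ij|ji|/val_inj ->].
  - by have [-> _] := gram _ _ ij; have [-> ->] := up j i (ltnW ij); rewrite !subr0.
  - rewrite formC //; have [-> _] := gram _ _ ji.
    by have [-> ->] := up i j (ltnW ji); ring.
  - by rewrite altA !subrr !mulr0 addr0.
have eB i j : form B (v i) (v j) = q i j - q j i.
  case: (ltngtP i j) => [ij|ji|/val_inj ->].
  - by have [_ ->] := gram _ _ ij; have [_ ->] := up j i (ltnW ij); rewrite !subr0.
  - rewrite formC //; have [_ ->] := gram _ _ ji.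
    by have [_ ->] := up i j (ltnW ji); ring.
  - by rewrite altB !subrr.
exists v, r, s; split=> //; apply: indep_row_free => c c0 i.
have /esym := form_suml B c v (v (Ordinal (pim i))); rewrite c0 form0l.
rewrite (bigD1 i) //= big1 ?addr0 => [/eqP|j ji].
  by rewrite eB mulf_eq0 /= (negbTE (_ : q i (pi i) - q (pi i) i != 0)) ?mono ?orbF // => /eqP.
by rewrite eB /= [_ - _](eqP (_ : _ == 0)) ?mulr0 //; apply: negbNE; rewrite mono eq_sym.
Qed.

(** * Brackets in coordinates and the passage from algebras to pencils *)

Lemma brDl (R : realType) n (c : strconst R n) u1 u2 v :
  br c (u1 + u2) v = br c u1 v + br c u2 v.
Proof.
rewrite /br -big_split; apply: eq_bigr => i _; rewrite -big_split.
by apply: eq_bigr => j _; rewrite mxE mulrDl scalerDl.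
Qed.

Lemma brDr (R : realType) n (c : strconst R n) u v1 v2 :
  br c u (v1 + v2) = br c u v1 + br c u v2.
Proof.
rewrite /br -big_split; apply: eq_bigr => i _; rewrite -big_split.
by apply: eq_bigr => j _; rewrite mxE mulrDr scalerDl.
Qed.

Lemma brZl (R : realType) n (c : strconst R n) k u v :
  br c (k *: u) v = k *: br c u v.
Proof.
rewrite /br scaler_sumr; apply: eq_bigr => i _; rewrite scaler_sumr.
by apply: eq_bigr => j _; rewrite mxE scalerA mulrA.
Qed.

Lemma brZr (R : realType) n (c : strconst R n) k u v :
  br c u (k *: v) = k *: br c u v.
Proof.
rewrite /br scaler_sumr; apply: eq_bigr => i _; rewrite scaler_sumr.
by apply: eq_bigr => j _; rewrite mxE scalerA mulrCA.
Qed.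

Lemma br0l (R : realType) n (c : strconst R n) v : br c 0 v = 0.
Proof. by have := brZl c 0 0 v; rewrite !scale0r. Qed.

Lemma br0r (R : realType) n (c : strconst R n) v : br c v 0 = 0.
Proof. by have := brZr c 0 v 0; rewrite !scale0r. Qed.

Lemma br_sum (R : realType) n (c : strconst R n) k l a b x y :
  br c (\sum_(i < k) a i *: x i) (\sum_(j < l) b j *: y j)
  = \sum_i \sum_j (a i * b j) *: br c (x i) (y j).
Proof.
have suml v : br c (\sum_(i < k) a i *: x i) v = \sum_i a i *: br c (x i) v.
  elim/big_rec2: _ => [|i z w _ <-]; first by rewrite br0l.
  by rewrite brDl brZl.
rewrite suml; apply: eq_bigr => i _.
rewrite (_ : br c (x i) _ = \sum_(j < l) b j *: br c (x i) (y j)).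
  by rewrite scaler_sumr; apply: eq_bigr => j _; rewrite scalerA.
elim/big_rec2: _ => [|j z w _ <-]; first by rewrite br0r.
by rewrite brDr brZr.
Qed.

Lemma br_delta (R : realType) n (c : strconst R n) i j :
  br c (delta_mx 0 i) (delta_mx 0 j) = c i j.
Proof.
rewrite /br (bigD1 i) //= [X in _ + X]big1 ?addr0; last first.
  by move=> k ki; rewrite big1 // => l _; rewrite mxE (negbTE ki) mul0r scale0r.
rewrite (bigD1 j) //= big1 ?addr0; last first.
  by move=> l lj; rewrite [delta_mx 0 j _ _]mxE (negbTE lj) mulr0 scale0r.
by rewrite !mxE !eqxx mulr1 scale1r.
Qed.

Lemma lie_iso_basis (R : realType) n (c d : strconst R n) (Q : 'M[R]_n) :
  Q \in unitmx ->
  (forall i j, br c (row i Q) (row j Q) = d i j *m Q) ->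
  lie_iso c d.
Proof.
move=> uQ eQ; exists (invmx Q); split; first by rewrite unitmx_inv.
suff brQ u v : br c (u *m Q) (v *m Q) = br d u v *m Q.
  by move=> u v; rewrite -[u in LHS](mulmxKV uQ) -[v in LHS](mulmxKV uQ) brQ mulmxK.
rewrite (mulmx_sum_row u) (mulmx_sum_row v) br_sum [br d _ _]/br mulmx_suml; apply: eq_bigr => i _.
by rewrite mulmx_suml; apply: eq_bigr => j _; rewrite eQ scalemxAl.
Qed.

(* The rows of [E] and [Z] form a basis, [Z] spanning the derived algebra; [A] and [B] are the
   coordinates along [Z] of the bracket of two vectors of the span of [E]. *)
Definition presents (R : realType) m (c : strconst R (m + 2))
    (E : 'M[R]_(m, m + 2)) (Z : 'M[R]_(2, m + 2)) (A B : 'M[R]_m) : Prop :=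
  [/\ col_mx E Z \in unitmx,
      forall u v, br c (u *m E) (v *m E)
        = form A u v *: row 0 Z + form B u v *: row 1 Z,
      forall k v, br c (row k Z) v = 0
    & forall u k, br c u (row k Z) = 0].

(** With [z0], [z1] the rows of [Z], [(r P + s Q) z0 + Q z1 = P (r z0) + Q (s z0 + z1)]: the central
    basis [r z0], [s z0 + z1], collected in [S], absorbs the shear. *)
Lemma presents_iso (R : realType) m (c d : strconst R (m + 2)) E Z A B p q :
  presents c E Z A B -> realizes A B p q -> tabulated d p q -> lie_iso c d.
Proof.
case=> uEZ eEE eZl eZr [v [r [s [r0 fv eA eB]]]] [dE dZl dZr].
pose V := \matrix_i v i.
pose S := \matrix_(i < 2) (if i == 0 then r *: row 0 Z else s *: row 0 Z + row 1 Z).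
pose Q := col_mx (V *m E) S.
have lS (w : 'rV_2) : w *m S = (w 0 0 * r + w 0 1 * s) *: row 0 Z + w 0 1 *: row 1 Z.
  rewrite mulmx_sum_row big_ord_recl big_ord1 !rowK /=.
  rewrite (_ : lift ord0 ord0 = 1); last exact: val_inj.
  by rewrite scalerDl scalerDr !scalerA addrA.
have lZ (w : 'rV[R]_2) : w *m Z = w 0 0 *: row 0 Z + w 0 1 *: row 1 Z.
  rewrite mulmx_sum_row big_ord_recl big_ord1.
  by rewrite (_ : lift ord0 ord0 = 1); last exact: val_inj.
have rowS k : exists w, row k S = w *m Z.
  exists (\row_j (if k == 0 then if j == 0 then r else 0 else if j == 0 then s else 1)).
  by rewrite rowK lZ !mxE /=; case: eqP => _; rewrite ?scale0r ?addr0 ?scale1r.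
apply: (@lie_iso_basis _ _ _ _ Q).
  rewrite -row_free_unit; apply: inj_row_free => w.
  rewrite -[w]hsubmxK mul_row_col lS mulmxA; move: (lsubmx w) (rsubmx w) => a b.
  pose b' : 'rV[R]_2 := \row_j (if j == 0 then b 0 0 * r + b 0 1 * s else b 0 1).
  have -> : (b 0 0 * r + b 0 1 * s) *: row 0 Z + b 0 1 *: row 1 Z = b' *m Z.
    by rewrite lZ !mxE.
  rewrite -mul_row_col => /(congr1 (mulmx^~ (invmx (col_mx E Z)))).
  rewrite mulmxK // mul0mx -(@row_mx0 _ 1 m 2) => /eq_row_mx [aV b0].
  have -> : a = 0.
    apply: (row_free_inj fv); by rewrite mul0mx.
  have b1 : b 0 1 = 0 by have := congr1 (fun x : 'rV_2 => x 0 1) b0; rewrite !mxE.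
  have b2 : b 0 0 = 0.
    have := congr1 (fun x : 'rV_2 => x 0 0) b0; rewrite !mxE /= b1 mul0r addr0.
    by move/eqP; rewrite mulf_eq0 (negbTE r0) orbF => /eqP.
  rewrite (_ : b = 0) ?row_mx0 //; apply/rowP => k; rewrite mxE.
  by case: k => [[|[|//]]] hk; [rewrite -[RHS]b2|rewrite -[RHS]b1]; congr (b _ _); exact: val_inj.
have brSl k w : br c (row k S) w = 0.
  by have [z ->] := rowS k; rewrite lZ brDl !brZl !eZl !scaler0 addr0.
have brSr k w : br c w (row k S) = 0.
  by have [z ->] := rowS k; rewrite lZ brDr !brZr !eZr !scaler0 addr0.
move=> i j; rewrite -(splitK i) -(splitK j).
case: (split i) => i' /=; last by rewrite /Q rowKd brSl dZl mul0mx.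
case: (split j) => j' /=; last by rewrite /Q rowKd brSr dZr mul0mx.
rewrite /Q !rowKu !row_mul !rowK eEE dE eA eB mulmxDl -!scalemxAl.
rewrite /centre_vec -!rowE !rowKd !rowK /=.
by rewrite scalerDr !scalerA scalerDl addrA mulrC [s * _]mulrC.
Qed.

Lemma presents_MD (R : realType) m (c : strconst R (m + 2)) :
  is_MD m c -> \rank (derived c) = 2%N -> in_centre c (derived c) ->
  exists E Z A B, presents c E Z A B /\ pencil A B.
Proof.
move=> [[alt _] [_ md]] rk cent; set D := derived c in md rk cent.
(* The size [\rank D] is kept in the type until the existential is closed, so that [rk] can rewrite
   it to 2. *)
have [Z [fZ eZ]] : exists Z : 'M_(2, m + 2), row_free Z /\ (Z :=: D)%MS.
  have : exists Z : 'M_(\rank D, m + 2), row_free Z /\ (Z :=: D)%MS.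
    by exists (row_base D); split; [exact: row_base_free|exact: eq_row_base].
  by rewrite rk.
have [E [fE eE]] : exists E : 'M_(m, m + 2), row_free E /\ (E :=: D^C)%MS.
  have rkC : \rank (D^C)%MS = m by rewrite mxrank_compl rk addnK.
  have : exists E : 'M_(\rank (D^C)%MS, m + 2), row_free E /\ (E :=: D^C)%MS.
    by exists (row_base (D^C)%MS); split; [exact: row_base_free|exact: eq_row_base].
  by rewrite rkC.
have uEZ : col_mx E Z \in unitmx.
  rewrite -row_full_unit -sub1mx -addsmxE addsmxC.
  by rewrite (adds_eqmx eZ eE) sub1mx addsmx_compl_full.
have altC u v : br c u v = - br c v u.
  move: (alt (u + v)); rewrite brDl !brDr !alt add0r addr0 => /eqP.
  by rewrite addr_eq0 => /eqP.
have cZl k v : br c (row k Z) v = 0.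
  by apply: cent; rewrite -eZ row_sub.
have cZr u k : br c u (row k Z) = 0 by rewrite altC cZl oppr0.
have lZ (w : 'rV[R]_2) : w *m Z = w 0 0 *: row 0 Z + w 0 1 *: row 1 Z.
  rewrite mulmx_sum_row big_ord_recl big_ord1.
  by rewrite (_ : lift ord0 ord0 = 1); last exact: val_inj.
have brD u v : (br c u v <= Z)%MS.
  rewrite eZ /br; apply: summx_sub => i _; apply: summx_sub => j _.
  apply: scalemx_sub; rewrite /D /derived /derived_sub.
  apply: (sumsmx_sup i) => //; apply: (sumsmx_sup j) => //.
  by rewrite genmxE !row1 br_delta.
pose co u v := br c u v *m pinvmx Z.
pose A := \matrix_(i, j) co (row i E) (row j E) 0 0.
pose B := \matrix_(i, j) co (row i E) (row j E) 0 1.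
have eEE u v : br c (u *m E) (v *m E) = form A u v *: row 0 Z + form B u v *: row 1 Z.
  rewrite !mulmx_sum_row br_sum !form_sum !scaler_suml -big_split; apply: eq_bigr => i _.
  rewrite !scaler_suml -big_split; apply: eq_bigr => j _ /=.
  rewrite -!scalerA -!scalerDr.
  by rewrite [A i j]mxE [B i j]mxE -(lZ (co _ _)) mulmxKpV.
exists E, Z, A, B; split; first by split.
have indZ a b : a *: row 0 Z + b *: row 1 Z = 0 -> a = 0 /\ b = 0.
  pose w : 'rV[R]_2 := \row_j (if j == 0 then a else b).
  move=> e; have w0 : w = 0.
    by apply: (row_free_inj fZ); rewrite mul0mx lZ !mxE.
  have := congr1 (fun x : 'rV_2 => x 0 0) w0; have := congr1 (fun x : 'rV_2 => x 0 1) w0.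
  by rewrite !mxE.
split=> [u|u|s t st].
- by have := alt (u *m E); rewrite eEE => /indZ [].
- by have := alt (u *m E); rewrite eEE => /indZ [].
pose w : 'cV[R]_2 := \col_j (if j == 0 then s else t).
(* The functional that vanishes on [E] and takes the values [s], [t] on the rows of [Z]. In the
   basis [E], [Z] its orbit matrix is [s A + t B] bordered by zeros. *)
pose F := invmx (col_mx E Z) *m col_mx (0 : 'cV_m) w.
have FZ a b : appF F (a *: row 0 Z + b *: row 1 Z) = s * a + t * b.
  pose x : 'rV[R]_2 := \row_j (if j == 0 then a else b).
  have -> : a *: row 0 Z + b *: row 1 Z = x *m Z by rewrite lZ !mxE.
  rewrite /appF -[x *m Z]add0r -(mul0mx _ E) -mul_row_col.
  rewrite /F mulmxA mulmxK // mul_row_col mul0mx add0r !mxE big_ord_recl big_ord1 !mxE /=.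
  by rewrite mulrC [b * _]mulrC.
have := md F; rewrite /orbit_dim; set M := \matrix_(i, j) _.
have eM u v : (u *m M *m v^T) 0 0 = appF F (br c u v).
  rewrite -/(form M u v) form_sum /appF /br mulmx_suml summxE; apply: eq_bigr => i _.
  rewrite mulmx_suml summxE; apply: eq_bigr => j _.
  by rewrite mxE -scalemxAl mxE.
move=> rkM.
have {rkM} rkM : \rank M = m.
  apply: rkM.
  (* On this vector [F] takes the value [s^2 + t^2], which is nonzero. *)
  exists (s *: row 0 Z + t *: row 1 Z); split.
    by rewrite -eZ addmx_sub // scalemx_sub // row_sub.
  by rewrite FZ -!expr2 paddr_eq0 ?sqr_ge0 // !sqrf_eq0 negb_and.
have eblock : col_mx E Z *m M *m (col_mx E Z)^T = block_mx (s *: A + t *: B) 0 0 0.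
  apply/matrixP => i j.
  have -> : (col_mx E Z *m M *m (col_mx E Z)^T) i j
      = appF F (br c (row i (col_mx E Z)) (row j (col_mx E Z))).
    rewrite -eM tr_row -!row_mul [LHS]mxE [RHS]mxE [RHS]mxE; apply: eq_bigr => k _.
    by rewrite [col _ _ _ _]mxE.
  rewrite -(splitK i) -(splitK j).
  case: (split i) => i' /=; last first.
    rewrite rowKd cZl /appF mul0mx mxE.
    by case: (split j) => j' /=; rewrite (block_mxEdl, block_mxEdr) mxE.
  case: (split j) => j' /=; last by rewrite rowKd cZr block_mxEur mxE /appF mul0mx mxE.
  rewrite !rowKu block_mxEul -(mul1mx E) !row_mul eEE FZ -form_comb.
  by rewrite /form !row1 trmx_delta -rowE -colE !mxE.
have rkb : \rank (block_mx (s *: A + t *: B) (0 : 'M_(m, 2)) (0 : 'M_(2, m)) 0)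
    = \rank (s *: A + t *: B)%R.
  by rewrite /block_mx row_mx0 rank_col_mx0 rank_row_mx0.
rewrite -row_free_unit; apply/eqP; rewrite -rkb -eblock mxrankMfree.
  by rewrite eqmxMfull // row_full_unit.
by rewrite row_free_unit unitmx_tr.
Qed.

(** * Tables of the model algebras, split into the two central coordinates *)

Lemma tabulated_sc (R : realType) m (f : nat -> nat -> 'rV[R]_(m + 2))
    (p q : nat -> nat -> R) :
  (forall i j, f i j = p i j *: centre_vec R m 0 + q i j *: centre_vec R m 1) ->
  (forall i j, (m <= i)%N -> p i j = 0 /\ q i j = 0) ->
  (forall i j, (m <= j)%N -> p i j = 0 /\ q i j = 0) ->
  tabulated (sc f) p q.
Proof.
move=> ef zl zr; split=> [i j|k j|i k]; rewrite /sc !ef.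
- by rewrite !scalerBl addrACA -opprD.
- have [-> ->] := zl (m + k)%N j (leq_addr _ _).
  by have [-> ->] := zr j (m + k)%N (leq_addr _ _); rewrite !scale0r addr0 subrr.
- have [-> ->] := zl (m + k)%N i (leq_addr _ _).
  by have [-> ->] := zr i (m + k)%N (leq_addr _ _); rewrite !scale0r addr0 subrr.
Qed.

Definition p6 (R : realType) (i j : nat) : R :=
  match i, j with 0, 2 => 1 | 1, 3 => -1 | _, _ => 0 end.
Definition q6 (R : realType) (i j : nat) : R :=
  match i, j with 0, 3 => -1 | 1, 2 => -1 | _, _ => 0 end.

Definition p10_1 (R : realType) (mu lam : R) (i j : nat) : R :=
  match i, j with
  | 0, 2 => 1 | 1, 3 => -1
  | 4, 6 => lam | 4, 7 => mu | 5, 6 => mu | 5, 7 => - lam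
  | _, _ => 0
  end.
Definition q10_1 (R : realType) (i j : nat) : R :=
  match i, j with
  | 0, 3 => -1 | 1, 2 => -1 | 4, 7 => -1 | 5, 6 => -1 | _, _ => 0
  end.

Definition p10_2 (R : realType) (lam : R) (i j : nat) : R :=
  match i, j with
  | 0, 6 => lam | 1, 7 => - lam
  | 2, 4 => lam | 2, 7 => 1 | 3, 5 => - lam | 3, 6 => 1
  | _, _ => 0
  end.
Definition q10_2 (R : realType) (i j : nat) : R :=
  match i, j with
  | 0, 7 => -1 | 1, 6 => -1 | 2, 5 => -1 | 3, 4 => -1 | _, _ => 0
  end.

Lemma tabulated_G6 (R : realType) : @tabulated R 4 (G6 R) (p6 R) (q6 R).
Proof.
have e0 : ee R 5 4 = centre_vec R 4 0 by congr delta_mx; apply/val_inj; rewrite /= inordK.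
have e1 : ee R 5 5 = centre_vec R 4 1 by congr delta_mx; apply/val_inj; rewrite /= inordK.
apply: (@tabulated_sc R 4) => i j.
2: by do 4 try (case: i => [|i] //=).
2: by do 4 try (case: i => [|i] //=); do 4 try (case: j => [|j] //=).
rewrite -e0 -e1; do 2 try (case: i => [|i] /=); do 4 try (case: j => [|j] /=);
  by rewrite ?scale0r ?scale1r ?scaleN1r ?addr0 ?add0r.
Qed.

Lemma tabulated_G10_1 (R : realType) (mu lam : R) :
  @tabulated R 8 (G10_1 mu lam) (p10_1 mu lam) (q10_1 R).
Proof.
have e0 : ee R 9 8 = centre_vec R 8 0 by congr delta_mx; apply/val_inj; rewrite /= inordK.
have e1 : ee R 9 9 = centre_vec R 8 1 by congr delta_mx; apply/val_inj; rewrite /= inordK.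
apply: (@tabulated_sc R 8) => i j.
2: by do 8 try (case: i => [|i] //=).
2: by do 8 try (case: i => [|i] //=); do 8 try (case: j => [|j] //=).
rewrite -e0 -e1; do 6 try (case: i => [|i] /=); do 8 try (case: j => [|j] /=);
  by rewrite ?scale0r ?scale1r ?scaleN1r ?scaleNr ?addr0 ?add0r.
Qed.

Lemma tabulated_G10_2 (R : realType) (lam : R) :
  @tabulated R 8 (G10_2 lam) (p10_2 lam) (q10_2 R).
Proof.
have e0 : ee R 9 8 = centre_vec R 8 0 by congr delta_mx; apply/val_inj; rewrite /= inordK.
have e1 : ee R 9 9 = centre_vec R 8 1 by congr delta_mx; apply/val_inj; rewrite /= inordK.
apply: (@tabulated_sc R 8) => i j.
2: by do 8 try (case: i => [|i] //=).
2: by do 8 try (case: i => [|i] //=); do 8 try (case: j => [|j] //=).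
rewrite -e0 -e1; do 4 try (case: i => [|i] /=); do 8 try (case: j => [|j] /=);
  by rewrite ?scale0r ?scale1r ?scaleN1r ?scaleNr ?addr0 ?add0r.
Qed.

(** * Gram matrices of the normal bases *)

Ltac upper_triangular i j :=
  do 8 try (case: i => [|i] //=); do 8 try (case: j => [|j] //=).

Ltac ord_cases i := case: i => -[|[|[|[|[|[|[|[|?]]]]]]]] ? //.

(** Reduces a Gram entry to the values [form B (orb T i u) v]; those with [u = v] vanish by
    isotropy. *)
Ltac eval_form AB :=
  rewrite ?(formDl, formDr, formZl, formZr, formNl, formNr)
    ?(formA_orb _ _ _ _ AB) ?(formB_orb _ _ _ _ AB) ?addn0 ?add0n ?addnS
    ?(formB_orb_diag _ _ AB).

(* [pencil_op A B] acts on [a] as [l J - k], where [J] is a complex structure, and [a], [y] are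
   normalised so that [form B (a J) y = 1]. *)
Definition quadratic_pair (R : realType) m (A B : 'M[R]_m) (k l : R) (a y : 'rV[R]_m) :=
  [/\ a *m pencil_op A B *m pencil_op A B
        = - (2 * k) *: (a *m pencil_op A B) - (k ^+ 2 + l ^+ 2) *: a,
      form B a y = 0
    & form B (a *m pencil_op A B) y = l].

(** The recurrence [h (i+2) = - 2 k h (i+1) - (k^2 + l^2) h i]. Index 3 suffices: each block vector
    has degree at most 1 in [T], and [A] adds one more. *)
Lemma quadratic_pair_form (R : realType) m (A B : 'M[R]_m) (k l : R) (a y : 'rV_m) :
  quadratic_pair A B k l a y ->
  let h i := form B (orb (pencil_op A B) i a) y in
  [/\ h 0%N = 0, h 1%N = l, h 2%N = - (2 * k * l)
    & h 3%N = (3 * k ^+ 2 - l ^+ 2) * l].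
Proof.
case=> e2 h0 h1; rewrite /orb /=; split=> //; first by rewrite e2 formDl !(formZl, formNl) h0 h1; ring.
rewrite e2 mulmxDl mulNmx -!scalemxAl e2 !(formDl, formZl, formNl) h0 h1; ring.
Qed.

(* The vector [- a J], for [T = l J - k]. *)
Definition block_vec (R : realType) m (T : 'M[R]_m) (k l : R) (a : 'rV[R]_m) :=
  (- l^-1) *: (orb T 1 a + k *: orb T 0 a).

(** Since [T = l J - k] on [a], and [B (u J) v] gives the table [p6], one gets [A = l P - k Q]. *)
Lemma realizes_G6 (R : realType) (A B : 'M[R]_4) (k l : R) (a y : 'rV_4) :
  pencil A B -> l != 0 -> quadratic_pair A B k l a y ->
  realizes A B (p6 R) (q6 R).
Proof.
move=> AB l0 /quadratic_pair_form; set T := pencil_op A B => -[h0 h1 h2 h3].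
have [altA altB _] := AB.
pose v (i : 'I_4) := nth 0 [:: orb T 0 a; block_vec T k l a; orb T 0 y; block_vec T k l y] i.
apply: (@realizes_gram _ _ _ _ v l (- k) _ _ (fun i => (3 - i)%N)) => //.
- by move=> i j; upper_triangular i j.
- by move=> i; rewrite ltnS leq_subr.
- by move=> i j; ord_cases i; ord_cases j; rewrite /= ?subrr ?subr0 ?sub0r ?oppr_eq0 ?oner_eq0 ?eqxx.
move=> i j; ord_cases i; ord_cases j; rewrite //= /v /block_vec /= => _;
  split; eval_form AB; rewrite -?/T ?h0 ?h1 ?h2 ?h3; by field.
Qed.

(** The first block fixes the shear [A = l P - k Q]. On the second,
    [(T + k) / l = (l' / l) J' - (k' - k) / l], whence both parameters; the entries -1 of [q10_1]
    make the second one positive. *)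
Lemma realizes_G10_1 (R : realType) (A B : 'M[R]_8) (k l k' l' : R)
    (a y b z : 'rV_8) :
  pencil A B -> l != 0 -> l' != 0 ->
  quadratic_pair A B k l a y -> quadratic_pair A B k' l' b z ->
  (forall i, [/\ form B (orb (pencil_op A B) i a) b = 0,
                 form B (orb (pencil_op A B) i a) z = 0,
                 form B (orb (pencil_op A B) i y) b = 0
               & form B (orb (pencil_op A B) i y) z = 0]) ->
  realizes A B (p10_1 ((k' - k) / l) (l' / l)) (q10_1 R).
Proof.
move=> AB l0 l0' /quadratic_pair_form + /quadratic_pair_form.
set T := pencil_op A B => -[h0 h1 h2 h3] [g0 g1 g2 g3] orth.
have oab i : form B (orb T i a) b = 0 by case: (orth i).
have oaz i : form B (orb T i a) z = 0 by case: (orth i).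
have oyb i : form B (orb T i y) b = 0 by case: (orth i).
have oyz i : form B (orb T i y) z = 0 by case: (orth i).
have [altA altB _] := AB.
pose v (i : 'I_8) := nth 0 [:: orb T 0 a; block_vec T k l a; orb T 0 y; block_vec T k l y;
  orb T 0 b; block_vec T k' l' b; orb T 0 z; block_vec T k' l' z] i.
apply: (@realizes_gram _ _ _ _ v l (- k) _ _ (nth 0%N [:: 3; 2; 1; 0; 7; 6; 5; 4]%N)) => //.
- by move=> i j; upper_triangular i j.
- by move=> i; ord_cases i.
- by move=> i j; ord_cases i; ord_cases j; rewrite /= ?subrr ?subr0 ?sub0r ?oppr_eq0 ?oner_eq0 ?eqxx.
move=> i j; ord_cases i; ord_cases j; rewrite //= /v /block_vec /= => _;
  split; eval_form AB; rewrite -?/T ?oab ?oaz ?oyb ?oyz ?h0 ?h1 ?h2 ?h3 ?g0 ?g1 ?g2 ?g3;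
  by field; rewrite ?l0 ?l0'.
Qed.

(* With [N = T ^ 2 + 1] and [x N ^ 2 = 0], these are the first, second and fourth vectors of the
   basis of G10_2(1) whose third vector is [x]: [x N T / 2], [x N / 2] and [- x T - x N T / 2]. *)
Definition nilp_vec1 (R : realType) m (T : 'M[R]_m) (x : 'rV[R]_m) :=
  2^-1 *: (orb T 3 x + orb T 1 x).
Definition nilp_vec2 (R : realType) m (T : 'M[R]_m) (x : 'rV[R]_m) :=
  2^-1 *: (orb T 2 x + orb T 0 x).
Definition nilp_vec4 (R : realType) m (T : 'M[R]_m) (x : 'rV[R]_m) :=
  - (orb T 1 x + nilp_vec1 T x).

(** The first relation is [x N^2 = 0]; its recurrence extends the four given values up to index 7,
    the largest one that occurs. The value -2 is halved to the entries -1 of [q10_2]. *)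
Lemma realizes_G10_2 (R : realType) (A B : 'M[R]_8) (x y : 'rV_8) :
  pencil A B ->
  let T := pencil_op A B in
  orb T 4 x = - 2 *: orb T 2 x - orb T 0 x ->
  form B (orb T 0 x) y = 0 -> form B (orb T 1 x) y = 0 ->
  form B (orb T 2 x) y = -2 -> form B (orb T 3 x) y = 0 ->
  realizes A B (p10_2 1) (q10_2 R).
Proof.
move=> AB T e4 h0 h1 h2 h3.
have hS i : form B (orb T (i + 4) x) y
    = - 2 * form B (orb T (i + 2) x) y - form B (orb T i x) y.
  by rewrite orbD e4 -scaleN1r orbDv !orbZv -!orbD formDl !formZl addn0 mulN1r.
have h4 := hS 0%N; rewrite /= add0n h2 h0 in h4.
have h5 := hS 1%N; rewrite /= add1n h3 h1 in h5.
have h6 := hS 2%N; rewrite /= (_ : (2 + 4 = 6)%N) // (_ : (2 + 2 = 4)%N) // h4 h2 in h6.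
have h7 := hS 3%N; rewrite /= (_ : (3 + 4 = 7)%N) // (_ : (3 + 2 = 5)%N) // h5 h3 in h7.
have [altA altB _] := AB.
pose v (i : 'I_8) := nth 0 [:: nilp_vec1 T x; nilp_vec2 T x; orb T 0 x; nilp_vec4 T x;
  nilp_vec1 T y; nilp_vec2 T y; orb T 0 y; nilp_vec4 T y] i.
apply: (@realizes_gram _ _ _ _ v 1 0 _ _ (fun i => (7 - i)%N)) => //.
- exact: oner_neq0.
- by move=> i j; upper_triangular i j.
- by move=> i; rewrite ltnS leq_subr.
- by move=> i j; ord_cases i; ord_cases j; rewrite /= ?subrr ?subr0 ?sub0r ?oppr_eq0 ?oner_eq0 ?eqxx.
move=> i j; ord_cases i; ord_cases j; rewrite //= /v /nilp_vec4 /nilp_vec1 /nilp_vec2 /= => _;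
  split; eval_form AB; rewrite -?/T ?h0 ?h1 ?h2 ?h3 ?h4 ?h5 ?h6 ?h7; by field.
Qed.

(** * Quadratic vectors and dimension four *)

(** Were the roots real, [(T - a)^2] would kill [w], and [w] or [w (T - a)] would be a real
    eigenvector. The predicate [S] allows the search to stay in an invariant subspace. *)
Lemma pencil_quadratic_vector (R : realType) m (A B : 'M[R]_m)
    (S : 'rV[R]_m -> Prop) (u : 'rV[R]_m) :
  pencil A B ->
  (forall s t v, S v ->
     S (v *m pencil_op A B *m pencil_op A B + s *: (v *m pencil_op A B) + t *: v)) ->
  S u -> u != 0 ->
  exists k l w, [/\ 0 < l, S w, w != 0 &
    w *m pencil_op A B *m pencil_op A B
    = - (2 * k) *: (w *m pencil_op A B) - (k ^+ 2 + l ^+ 2) *: w].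
Proof.
move=> AB stab Su u0; set T := pencil_op A B.
have [|a [b [w [Sw w0 ew]]]] := @ex_quadratic_vector R m T S u _ Su u0.
  by move=> a b v Sv; rewrite -scaleNr; apply: stab.
exists (- a), `|b|, w; split=> //; last first.
  by rewrite mulrN opprK sqrrN real_normK ?num_real.
rewrite normr_gt0; apply/eqP => b0; rewrite b0 expr0n addr0 in ew.
have [|w1] := eqVneq (w *m T - a *: w) 0.
  rewrite addrC -scaleNr -[w *m T]scale1r => /(pencil_orb_indep AB w0) [_ /eqP].
  by rewrite oner_eq0.
have [|_ /eqP] := @pencil_orb_indep _ _ A B (- a) 1 _ AB w1; last by rewrite oner_eq0.
rewrite -/T mulmxBl ew -scalemxAl scale1r; move: (w *m T) => x.
by apply/rowP => i; rewrite !mxE; ring.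
Qed.

Lemma indep_pair (R : realType) m (A B : 'M[R]_m) (a : 'rV[R]_m) :
  pencil A B -> a != 0 ->
  @indep R m 2 (nth 0 [:: a; a *m pencil_op A B]).
Proof.
move=> AB a0 c; rewrite big_ord_recl big_ord1 /= => /(pencil_orb_indep AB a0) [c0 c1] i.
by ord_cases i; [rewrite -[RHS]c0|rewrite -[RHS]c1]; congr c; apply: val_inj.
Qed.

Lemma quadratic_orb0 (R : realType) m (T B : 'M[R]_m) s t (a v : 'rV[R]_m) :
  a *m T *m T = s *: (a *m T) + t *: a ->
  form B a v = 0 -> form B (a *m T) v = 0 -> forall i, form B (orb T i a) v = 0.
Proof.
move=> ea h0 h1 i; suff [] : form B (orb T i a) v = 0 /\ form B (orb T i.+1 a) v = 0 by [].
elim: i => // i [e0 e1]; split=> //.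
rewrite -addn2 orbD (_ : orb T 2 a = s *: orb T 1 a + t *: orb T 0 a) //.
by rewrite orbDv !orbZv -!orbD addn1 addn0 formDl !formZl e0 e1 !mulr0 addr0.
Qed.

Lemma pencil4_G6 (R : realType) (A B : 'M[R]_4) :
  pencil A B -> realizes A B (p6 R) (q6 R).
Proof.
move=> AB.
have d0 : delta_mx 0 0 != 0 :> 'rV[R]_4.
  by apply/eqP => /rowP /(_ 0); rewrite !mxE !eqxx => /eqP; rewrite oner_eq0.
have [//|k [l [a [l0 _ a0 ea]]]] :=
  @pencil_quadratic_vector _ _ A B (fun=> True) _ AB _ I d0.
have [y hy] := form_solve (nth 0 [:: 0; l]) (pencil_unit AB) (indep_pair AB a0).
apply: (realizes_G6 AB (lt0r_neq0 l0)); split; first exact: ea.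
- exact: hy 0.
- exact: hy 1.
Qed.

(** * Pencils in dimension eight *)

Section NormalizedPencil8.
Variables (R : realType) (A B : 'M[R]_8).
Hypothesis AB : pencil A B.
Let T := pencil_op A B.
Let N : 'M[R]_8 := T *m T + 1%:M.

Lemma mulvN (v : 'rV_8) : v *m N = v *m T *m T + v.
Proof. by rewrite mulmxDr mulmx1 mulmxA. Qed.

Lemma mulTN (v : 'rV_8) : v *m T *m N = v *m N *m T.
Proof. by rewrite !mulvN mulmxDl. Qed.

Lemma formN (u v : 'rV_8) : form B u (v *m N) = form B (u *m N) v.
Proof. by rewrite !mulvN formDl formDr !(form_op_sym _ _ AB). Qed.

Lemma nilpotent_G10_2 (x : 'rV_8) :
  x *m N != 0 -> x *m N *m N = 0 -> realizes A B (p10_2 1) (q10_2 R).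
Proof.
move=> xN xNN.
have ind : @indep R 8 4 (fun i => orb T i x).
  move=> c; rewrite !big_ord_recl big_ord0 addr0 /=.
  set c0 := c _; set c1 := c _; set c2 := c _; set c3 := c _.
  rewrite /bump /= !(orbS, add1n) [orb T 0 x]/orb /=.
  have e2 : x *m T *m T = x *m N - x by rewrite mulvN addrK.
  rewrite e2 mulmxBl => e.
  (* In terms of [x], [x T], [x N], [x N T], multiplication by [N] kills the last two terms and
     leaves a relation between [x N] and [x N T]. *)
  have e' : (c0 - c2) *: x + (c1 - c3) *: (x *m T) + c2 *: (x *m N) + c3 *: (x *m N *m T) = 0.
    rewrite -e; move: (x *m T) (x *m N) (x *m N *m T) => x1 x2 x3.
    by apply/rowP => i; rewrite !mxE; ring.
  have := congr1 (mulmx^~ N) e'; rewrite mul0mx !mulmxDl -!scalemxAl !mulTN xNN mul0mx.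
  rewrite !scaler0 !addr0 => /(pencil_orb_indep AB xN) [c02 c13].
  move: e'; rewrite c02 c13 !scale0r !add0r => /(pencil_orb_indep AB xN) [c20 c30].
  move: c02 c13; rewrite c20 c30 !subr0 => c00 c10 i.
  by ord_cases i; [rewrite -[RHS]c00|rewrite -[RHS]c10|rewrite -[RHS]c20|rewrite -[RHS]c30];
    congr c; apply: val_inj.
have [y hy] := form_solve (nth 0 [:: 0; 0; -2; 0]) (pencil_unit AB) ind.
apply: (@realizes_G10_2 _ _ _ x y AB).
- change (x *m T *m T *m T *m T = - 2 *: (x *m T *m T) - x).
  move: xNN; rewrite !mulvN !mulmxDl => /eqP; rewrite addr_eq0 => /eqP e4.
  rewrite -[LHS](addrK (x *m T *m T)) e4; move: (x *m T *m T) => x2.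
  by apply/rowP => i; rewrite !mxE; ring.
- exact: hy 0.
- exact: hy 1.
- exact: hy 2.
- exact: hy 3.
Qed.

(** The first block is [a], [a T], [y], [y T] with [y] in the kernel of [N]. Its orthogonal
    complement is [T]-stable by self-adjointness and supplies the second block from [b] and [z]. *)
Lemma semisimple_G10_1 (a : 'rV_8) :
  (forall x : 'rV_8, x *m N *m N = 0 -> x *m N = 0) -> a != 0 -> a *m N = 0 ->
  exists mu lam : R, 0 < `|lam| <= 1 /\ realizes A B (p10_1 mu lam) (q10_1 R).
Proof.
move=> ss a0 aN.
have [altA altB _] := AB.
(* [N] and [N ^ 2] have the same kernel, hence the same image; this lets the partner [y0] of [a]
   be corrected by a vector of the image of [N] into the kernel of [N]. *)
have NNN : (N <= N *m N)%MS.
  have sN : (N *m N <= N)%MS by exact: submxMl.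
  rewrite -(geq_leqif (mxrank_leqif_sup sN)).
  have : (kermx (N *m N) <= kermx N)%MS.
    apply/row_subP => i; apply/sub_kermxP; apply: ss.
    by rewrite -mulmxA -row_mul mulmx_ker row0.
  move=> /mxrankS; rewrite !mxrank_ker; have := rank_leq_row N.
  by have := rank_leq_row (N *m N); lia.
have [y0 hy0] := form_solve (nth 0 [:: 0; 1]) (pencil_unit AB) (indep_pair AB a0).
have /submxP [z0 ez0] : (y0 *m N <= N *m N)%MS.
  by apply: submx_trans NNN; exact: submxMl.
pose y := y0 - z0 *m N.
have yN : y *m N = 0 by rewrite mulmxBl ez0 mulmxA subrr.
have quad (v : 'rV_8) : v *m N = 0 -> v *m T *m T = 0 *: (v *m T) + (-1) *: v.
  by rewrite mulvN => /eqP; rewrite addr_eq0 => /eqP ->; rewrite scale0r add0r scaleN1r.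
(* As [N] is self-adjoint and [a N = 0], the correction does not change the pairings with [a]. *)
have ay0 : form B a y = 0.
  by rewrite formDr formNr formN aN form0l subr0; exact: hy0 0.
have ay1 : form B (a *m T) y = 1.
  by rewrite formDr formNr formN mulTN aN mul0mx form0l subr0; exact: hy0 1.
have qa : quadratic_pair A B 0 1 a y.
  split=> //; rewrite -/T quad // mulr0 oppr0 expr0n add0r expr1n.
  by rewrite scaleN1r scale1r.
have y1 : form B (y *m T) y = 0 := formB_orb_diag 1 y AB.
have a1 : form B (a *m T) a = 0 := formB_orb_diag 1 a AB.
(* The orthogonal complement of the first block, phrased with whole orbits so that stability under
   [T] is a shift of [i]. *)
pose S v := forall i, form B (orb T i a) v = 0 /\ form B (orb T i y) v = 0.
have SI v : form B a v = 0 -> form B (a *m T) v = 0 -> form B y v = 0 ->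
    form B (y *m T) v = 0 -> S v.
  move=> ? ? ? ? i.
  by split; [apply: (quadratic_orb0 (quad _ aN))|apply: (quadratic_orb0 (quad _ yN))].
have Sstab s t v : S v -> S (v *m T *m T + s *: (v *m T) + t *: v).
  move=> Sv i; rewrite !formDr !formZr -!(form_op_sym _ _ AB) -/T -!orbS.
  have [-> ->] := Sv i; have [-> ->] := Sv i.+1; have [-> ->] := Sv i.+2.
  by rewrite !mulr0 !addr0.
have [//|u u0 hu] := @ex_orthogonal R 8 4 B (nth 0 [:: a; a *m T; y; y *m T]).
have Su : S u by apply: SI; [exact: hu 0|exact: hu 1|exact: hu 2|exact: hu 3].
have [k [l [b [l0 Sb b0 qb]]]] := pencil_quadratic_vector AB Sstab Su u0.
(* Pairing with [y], [y T], [a], [a T] isolates the first four coefficients; what remains is a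
   relation between [b] and [b T]. *)
have ind : @indep R 8 6 (nth 0 [:: a; a *m T; y; y *m T; b; b *m T]).
  move=> c; rewrite !big_ord_recl big_ord0 addr0 /=.
  set c0 := c _; set c1 := c _; set c2 := c _; set c3 := c _; set c4 := c _; set c5 := c _.
  move=> e.
  have bo i j : form B (orb T i b) (orb T j a) = 0 /\ form B (orb T i b) (orb T j y) = 0.
    rewrite !(formC (orb T i b)) // !(formB_orb _ _ _ _ AB).
    by have [-> ->] := Sb (j + i)%N; rewrite oppr0.
  have [b00 b00'] := bo 0%N 0%N; have [b10 b10'] := bo 1%N 0%N.
  have [b01 b01'] := bo 0%N 1%N; have [b11 b11'] := bo 1%N 1%N.
  rewrite /orb /= in b00 b00' b10 b10' b01 b01' b11 b11'.
  have aTy : form B a (y *m T) = 1 by rewrite -(form_op_sym _ _ AB).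
  have aTyT : form B (a *m T) (y *m T) = 0.
    by rewrite -(form_op_sym _ _ AB) quad // formDl !formZl ay0 ay1 mul0r mulr0 addr0.
  have yTyT : form B y (y *m T) = 0 by rewrite -(form_op_sym _ _ AB).
  have aTa : form B a (a *m T) = 0 by rewrite -(form_op_sym _ _ AB).
  have ev v : c0 * form B a v + (c1 * form B (a *m T) v + (c2 * form B y v +
      (c3 * form B (y *m T) v + (c4 * form B b v + c5 * form B (b *m T) v)))) = 0.
    by rewrite -!formZl -!formDl e form0l.
  have c10 : c1 = 0.
    by have := ev y; rewrite ay0 ay1 altB y1 b00' b10' !mulr0 !addr0 add0r mulr1.
  have c00 : c0 = 0.
    by have := ev (y *m T); rewrite aTy aTyT yTyT altB b01' b11' !mulr0 !addr0 mulr1.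
  have c30 : c3 = 0.
    have := ev a; rewrite altB a1 (formC y) // ay0 (formC _ a) // aTy b00 b10.
    by rewrite !mulr0 oppr0 !mulr0 !addr0 !add0r mulrN1 => /eqP; rewrite oppr_eq0 => /eqP.
  have c20 : c2 = 0.
    have := ev (a *m T); rewrite aTa altB (formC y) // ay1 (formC (y *m T)) // aTyT b01 b11.
    by rewrite !mulr0 oppr0 !mulr0 !addr0 !add0r mulrN1 => /eqP; rewrite oppr_eq0 => /eqP.
  move: e; rewrite c00 c10 c20 c30 !scale0r !add0r => /(pencil_orb_indep AB b0) [c40 c50] i.
  by ord_cases i; [rewrite -[RHS]c00|rewrite -[RHS]c10|rewrite -[RHS]c20|rewrite -[RHS]c30
    |rewrite -[RHS]c40|rewrite -[RHS]c50]; congr c; apply: val_inj.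
(* The first four zeros put [z] in the complement; the last two values make it a partner of [b]. *)
have [z hz] := form_solve (nth 0 [:: 0; 0; 0; 0; 0; l]) (pencil_unit AB) ind.
have Sz : S z by apply: SI; [exact: hz 0|exact: hz 1|exact: hz 2|exact: hz 3].
have qbz : quadratic_pair A B k l b z.
  by split; [exact: qb|exact: hz 4|exact: hz 5].
have orth i : [/\ form B (orb T i a) b = 0, form B (orb T i a) z = 0,
    form B (orb T i y) b = 0 & form B (orb T i y) z = 0].
  by have [? ?] := Sb i; have [? ?] := Sz i.
have orth' i : [/\ form B (orb T i b) a = 0, form B (orb T i b) y = 0,
    form B (orb T i z) a = 0 & form B (orb T i z) y = 0].
  have sw v w : form B (orb T i v) w = - form B (orb T i w) v.
    rewrite formC //; congr (- _).
    exact: (formB_orb 0 i w v AB).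
  by have [ab az yb yz] := orth i; split; rewrite sw ?ab ?az ?yb ?yz oppr0.
(* The first block has parameters 0 and 1, so the ratio is [l], or [1 / l] after exchanging the
   blocks. *)
have [l1|l1] := lerP l 1.
  exists ((k - 0) / 1), (l / 1); split; first by rewrite divr1 gtr0_norm // l0.
  exact: (realizes_G10_1 AB (oner_neq0 _) (lt0r_neq0 l0) qa qbz orth).
exists ((0 - k) / l), (1 / l); split; last first.
  exact: (realizes_G10_1 AB (lt0r_neq0 l0) (oner_neq0 _) qbz qa orth').
by rewrite div1r normfV gtr0_norm // invr_gt0 l0 invf_le1 // ltW.
Qed.

End NormalizedPencil8.

Lemma pencil8_classification (R : realType) (A B : 'M[R]_8) :
  pencil A B ->
  (exists mu lam : R, 0 < `|lam| <= 1 /\ realizes A B (p10_1 mu lam) (q10_1 R)) \/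
  realizes A B (p10_2 1) (q10_2 R).
Proof.
move=> AB.
have d0 : delta_mx 0 0 != 0 :> 'rV[R]_8.
  by apply/eqP => /rowP /(_ 0); rewrite !mxE !eqxx => /eqP; rewrite oner_eq0.
have [//|k [l [a [l0 _ a0 ea]]]] :=
  @pencil_quadratic_vector _ _ A B (fun=> True) _ AB _ I d0.
have {}l0 := lt0r_neq0 l0.
(* As [(T + k)^2 + l^2] kills [a], the new operator [(T + k) / l] squares to -1 on [a]. *)
set A' := l^-1 *: A + (- (- k) / l) *: B.
have AB' : pencil A' B := pencil_affine (- k) l0 AB.
pose T' := pencil_op A' B; pose N := T' *m T' + 1%:M.
have aN : a *m N = 0.
  rewrite mulmxDr mulmx1 mulmxA !pencil_op_affine // -scalemxAl mulmxBl -scalemxAl ea.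
  move: (a *m _) => x; apply/rowP => i; rewrite !mxE; by field.
(* If the inclusion fails, some row of the kernel of [N^2] is not killed by [N] and generates the
   nilpotent case. *)
have [sub|/row_subPn [i ni]] := boolP (kermx (N *m N) <= kermx N)%MS.
  left; have [|mu [lam [hl re]]] := semisimple_G10_1 AB' _ a0 aN.
    move=> x; rewrite -mulmxA => /sub_kermxP xk; apply/sub_kermxP; exact: submx_trans xk sub.
  by exists mu, lam; split=> //; apply: realizes_affine re.
right; apply: realizes_affine l0 _; apply: (nilpotent_G10_2 AB' (x := row i (kermx (N *m N)))).
  by apply: contra ni => /eqP e; apply/sub_kermxP.
by rewrite -mulmxA -row_mul mulmx_ker row0.
Qed.

Theorem theorem4p7 (R : realType) :
  (forall c : strconst R 6,
     is_MD (6 - 2) c -> \rank (derived c) = 2%N -> in_centre c (derived c) ->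
     lie_iso c (G6 R)) /\
  (forall c : strconst R 10,
     is_MD (10 - 2) c -> \rank (derived c) = 2%N -> in_centre c (derived c) ->
     (exists (mu lam : R), 0 < `|lam| <= 1 /\ lie_iso c (G10_1 mu lam)) \/
     (exists lam : R, lam != 0 /\ lie_iso c (G10_2 lam))).
Proof.
split=> c md rk cent.
  have [E [Z [A [B [pres AB]]]]] := @presents_MD R 4 c md rk cent.
  exact: presents_iso pres (pencil4_G6 AB) (tabulated_G6 R).
have [E [Z [A [B [pres AB]]]]] := @presents_MD R 8 c md rk cent.
have [[mu [lam [hl re]]]|re] := pencil8_classification AB.
  by left; exists mu, lam; split=> //; exact: presents_iso pres re (tabulated_G10_1 mu lam).
right; exists 1; split; first exact: oner_neq0.
exact: presents_iso pres re (tabulated_G10_2 1).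
Qed.
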